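(* Let $F\colon\mathbb{R}^m\to\mathbb{R}$ be an averaging operator, let $f,g\in L^\infty(\mathbb{T}_m,\mathbb{R})$ be such that $f\le g$ in $\mathbb{T}_m$, and let $u,v\in L^{\infty}_{loc}([0,+\infty);L^\infty(\mathbb{T}_m,\mathbb{R}))$ be such that $$u(x,t)\le K_f u(x,t)\quad\text{and}\quad v(x,t)\ge K_g v(x,t)$$ for all $(x,t)\in\mathbb{T}_m\times[0,+\infty)$. Then $u\le v$ in $\mathbb{T}_m\times[0,+\infty)$.
   Context: Let $m\in\mathbb{N}$, $m>2$. $\mathbb{T}_m$ is the directed tree with regular $m$-branching: its vertices are the empty sequence $\emptyset$ and all finite sequences $(a_1,\dots,a_k)$, $k\in\mathbb{N}$, with $a_i\in\{0,1,\dots,m-1\}$. Each vertex $x$ has $m$ successors $(x,0),\dots,(x,m-1)$, obtained by appending one more coordinate to $x$. $L^\infty(\mathbb{T}_m,\mathbb{R})$ is the set of bounded functions $f\colon\mathbb{T}_m\to\mathbb{R}$. An averaging operator is a continuous function $F\colon\mathbb{R}^m\to\mathbb{R}$ such that: (i) $F(0,\dots,0)=0$ and $F(1,\dots,1)=1$; (ii) $F(tx_1,\dots,tx_m)=tF(x_1,\dots,x_m)$ for all $t\in\mathbb{R}$; (iii) $F(t+x_1,\dots,t+x_m)=t+F(x_1,\dots,x_m)$ for all $t\in\mathbb{R}$; (iv) $F(x_1,\dots,x_m)<\max\{x_1,\dots,x_m\}$ if not all $x_j$ are equal; (v) $F$ is nondecreasing with respect to each variable. $L^{\infty}_{loc}([0,+\infty);L^\infty(\mathbb{T}_m,\mathbb{R}))$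 is the set of functions $v$ on $\mathbb{T}_m\times[0,+\infty)$ (measurable in $t$) that are bounded on $\mathbb{T}_m\times[0,T]$ for every $T>0$. For $f\in L^\infty(\mathbb{T}_m,\mathbb{R})$ and $u$ in this space, $$K_f u(x,t):=\int_0^t e^{z-t}F(u((x,0),z),\dots,u((x,m-1),z))\,dz+e^{-t}f(x).$$ *)

(* Defs.v *)
From HB Require Import structures.
From mathcomp Require Import all_boot all_order all_algebra.
From mathcomp Require Import all_classical all_reals all_analysis.
Set Implicit Arguments.
Unset Strict Implicit.
Unset Printing Implicit Defensive.
Import Order.TTheory GRing.Theory Num.Theory.
Import numFieldNormedType.Exports.
Local Open Scope classical_set_scope.
Local Open Scope ring_scope.

Definition tree (m : nat) : Type := seq 'I_m.

Definition succ (m : nat) (x : tree m) (i : 'I_m) : tree m := rcons x i.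

(* The maximum in [avg_lt_max] is taken over the coordinates of [x] only: the
   seed of the iterated maximum is itself one of them. *)
Record averaging_operator (R : realType) (m : nat) (F : 'rV[R]_m -> R)
    : Prop := {
  avg_continuous : continuous F;
  avg_0 : F 0 = 0;
  avg_1 : F (const_mx 1) = 1;
  avg_scale : forall (t : R) (x : 'rV[R]_m), F (t *: x) = t * F x;
  avg_translate :
    forall (t : R) (x : 'rV[R]_m), F (const_mx t + x) = t + F x;
  avg_lt_max : forall (x : 'rV[R]_m) (i0 : 'I_m),
    ~ (forall j k : 'I_m, x ord0 j = x ord0 k) ->
    F x < \big[Order.max/x ord0 i0]_(j < m) x ord0 j;
  avg_nondecreasing : forall (x y : 'rV[R]_m) (i : 'I_m),
    (forall j : 'I_m, j != i -> x ord0 j = y ord0 j) ->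
    x ord0 i <= y ord0 i -> F x <= F y }.

(* The real line with the sigma-algebra of Lebesgue measurable sets, that is,
   the domain of [completed_lebesgue_measure]; the default sigma-algebra of the
   library on [R] is the Borel one. *)
Definition lebesgueR (R : realType) :=
  caratheodory_type ((wlength (@idfun R))^*)%mu.

Definition Linfty (R : realType) (m : nat) (f : tree m -> R) : Prop :=
  bounded_fun f.

(* Functions of time are total on [R]; their values at negative times are
   never used. *)
Definition Linfty_loc (R : realType) (m : nat) (v : tree m -> R -> R) : Prop :=
  (forall x : tree m,
     measurable_fun (`[0, +oo[%classic : set (lebesgueR R)) (v x)) /\
  (forall T : R, 0 < T ->
     [bounded v p.1 p.2 | p in [set p : tree m * R | 0 <= p.2 <= T]]).

Definition K (R : realType) (m : nat) (F : 'rV[R]_m -> R) (f : tree m -> R)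
    (u : tree m -> R -> R) (x : tree m) (t : R) : R :=
  Rintegral (@completed_lebesgue_measure R) `[0, t]%classic
    (fun z => expR (z - t) * F (\row_(i < m) u (succ x i) z))
  + expR (- t) * f x.

(* Main.v *)
Require Import Defs.
From HB Require Import structures.
From mathcomp Require Import all_boot all_order all_algebra.
From mathcomp Require Import all_classical all_reals all_analysis.
From mathcomp Require Import measurable_realfun lra.
Import Order.TTheory GRing.Theory Num.Theory.
Import numFieldNormedType.Exports.
Local Open Scope ring_scope.

(** The comparison principle holds because the difference of two applications
of [K] is a contraction on bounded time intervals, uniformly over the tree.

An averaging operator is monotone and commutes with adding constants, so
[a <= b + c] coordinatewise gives [F a <= F b + c] ([averaging_le_shift]).
If [u - v <= B] on the whole tree during [0, T], with [B >= 0], then at every vertex and at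
every time [t <= T]
  [u - v <= K_f u - K_g v <= \int_0^t e^(z - t) B dz + e^(- t) (f - g)
         <= B (1 - e^(- t)) <= B (1 - e^(- T))]   ([K_contraction]).
Local boundedness supplies a first constant [B]; iterating,
[u - v <= B (1 - e^(- T))^n] on [0, T] for all [n], and the factor
[1 - e^(- T)] lies in [0, 1), so that [u - v <= 0].  The tree enters only
through the uniformity of the bounds in the vertex.

What remains is to justify the comparison of integrals, since the integral of
a non-integrable function carries no information.  The integrands are bounded
([averaging_bounded]), and they are Lebesgue measurable because the
superlevel sets of [F] are countable unions of orthants with rational vertices
([averaging_measurable]). *)

(** * Averaging operators *)

Section AveragingOperator.
Set Implicit Arguments.
Unset Strict Implicit.
Local Open Scope classical_set_scope.
Context {R : realType} {m : nat} (F : 'rV[R]_m -> R).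
Hypothesis hF : averaging_operator F.

(** The axiom compares vectors that differ in a single coordinate, so the
coordinates of [a] are replaced by those of [b] one after the other. *)
Lemma averaging_monotone (a b : 'rV[R]_m) :
  (forall j, a ord0 j <= b ord0 j) -> F a <= F b.
Proof.
move=> ab.
pose h k : 'rV[R]_m := \row_j if (j < k)%N then b ord0 j else a ord0 j.
have -> : a = h 0 by apply/rowP => j; rewrite mxE.
have -> : b = h m by apply/rowP => j; rewrite mxE ltn_ord.
elim: {1 3}m (leqnn m) => // k IH km.
apply: (le_trans (IH (ltnW km))).
apply: (avg_nondecreasing hF (i := Ordinal km)) => [j jk|]; rewrite !mxE /=.
- have /negbTE jk' : (j : nat) != k by exact: jk.
  by rewrite ltnS [(j <= k)%N]leq_eqVlt jk'.
- by rewrite ltnn ltnSn.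
Qed.

Lemma averaging_le_shift (a b : 'rV[R]_m) (c : R) :
  (forall j, a ord0 j <= b ord0 j + c) -> F a <= F b + c.
Proof.
move=> abc; rewrite addrC -(avg_translate hF).
by apply: averaging_monotone => j; rewrite !mxE addrC.
Qed.

Lemma averaging_bounded (a : 'rV[R]_m) (M : R) :
  (forall j, `|a ord0 j| <= M) -> `|F a| <= M.
Proof.
move=> aM; rewrite ler_norml; apply/andP; split.
- rewrite -subr_ge0 opprK -(avg_0 hF).
  apply: averaging_le_shift => j; rewrite mxE.
  by move: (aM j); rewrite ler_norml => /andP[? _]; lra.
- rewrite -[leRHS]add0r -(avg_0 hF).
  apply: averaging_le_shift => j; rewrite mxE add0r.
  exact: le_trans (ler_norm _) (aM j).
Qed.

(** The bound [averaging_le_shift] makes [F] lose at most [e] when every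
coordinate is lowered by at most [e]; here [e = F a - c]. *)
Lemma averaging_rational_approx (a : 'rV[R]_m) (c : R) :
  c < F a ->
  exists q : 'rV[rat]_m, c <= F (map_mx ratr q) /\
    forall j, ratr (q ord0 j) <= a ord0 j.
Proof.
move=> cF.
have qP j : exists q : rat, a ord0 j - (F a - c) < ratr q < a ord0 j.
  have /rat_in_itvoo[q] : a ord0 j - (F a - c) < a ord0 j by lra.
  by rewrite in_itv/=; exists q.
have [q {}qP] := choice qP.
exists (\row_j q j); split; last first.
  by move=> j; rewrite mxE; have /andP[_ /ltW] := qP j.
rewrite -(lerD2r (F a - c)) addrC subrK.
apply: averaging_le_shift => j; rewrite !mxE.
by have /andP[? _] := qP j; lra.
Qed.

(** By monotonicity, [c < F a] as soon as [a] dominates a rational vector [q]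
with [c < F q], and the approximation above provides such a [q].  So the set
where [F] exceeds [c] along [h] is a countable union, over [q], of finite
intersections of superlevel sets of the functions [h j]. *)
Lemma averaging_measurable d (T : measurableType d) (D : set T)
    (h : 'I_m -> T -> R) :
  (forall j, measurable_fun D (h j)) ->
  measurable_fun D (fun z => F (\row_j h j z)).
Proof.
move=> mh mD; apply: (measurability _ (RGenOInfty.measurableE R)) => //.
move=> _ [_ [c ->] <-].
pose A (p : 'rV[rat]_m) : set T :=
  if c < F (map_mx ratr p) then
    \bigcap_j (D `&` h j @^-1` `[ratr (p ord0 j), +oo[%classic)
  else set0.
rewrite [X in measurable X](_ : _ = D `&` \bigcup_p A p).
  apply: measurableI => //; apply: countable_bigcupT_measurable => [|p].
    exact: countableP.
  rewrite /A; case: ifP => // _.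
  apply: fin_bigcap_measurable => // j _; exact: mh.
apply/seteqP; split=> z /=; rewrite in_itv/= andbT => -[Dz].
  move=> cF; split=> //.
  (* Aiming at the midpoint leaves room for the strict bound [c < F q]. *)
  have cF2 : (c + F (\row_j h j z)) / 2 < F (\row_j h j z) by lra.
  have [q [cq qh]] := averaging_rational_approx cF2.
  exists q => //; rewrite /A ifT; last by apply: lt_le_trans cq; lra.
  move=> j _; split=> //=; rewrite in_itv/= andbT.
  by have := qh j; rewrite mxE.
move=> [q _]; rewrite /A; case: ifP => // cq Aq; split=> //.
apply: (lt_le_trans cq); apply: averaging_monotone => j; rewrite !mxE.
by have [_] := Aq j I; rewrite /= in_itv/= andbT.
Qed.

End AveragingOperator.

(** * Integration with respect to the completed Lebesgue measure *)

Section LebesgueTime.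
Set Implicit Arguments.
Unset Strict Implicit.
Local Open Scope classical_set_scope.
Context {R : realType}.
Notation mu := (@completed_lebesgue_measure R).

Lemma id_lebesgue_borel_measurable (D : set (lebesgueR R)) :
  measurable_fun D (id : lebesgueR R -> measurableTypeR R).
Proof.
move=> mD B mB; apply: measurableI => //; exact: sub_caratheodory.
Qed.

Lemma itv_lebesgue_measurable (i : interval R) :
  measurable ([set` i] : set (lebesgueR R)).
Proof. by apply: sub_caratheodory; exact: measurable_itv. Qed.

Lemma expRB_continuous (t : R) : continuous (fun z : R => expR (z - t)).
Proof.
move=> z; apply: continuous_comp; last exact: continuous_expR.
by apply: cvgB; [exact: cvg_id|exact: cvg_cst].
Qed.

Lemma expRB_measurable (D : set (lebesgueR R)) (t : R) :
  measurable_fun D (fun z => expR (z - t)).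
Proof.
apply: (@measurableT_comp _ _ _ _ _ _
  (fun z : measurableTypeR R => expR (z - t)) _ (id : lebesgueR R -> _)).
- by apply: continuous_measurable_fun; exact: expRB_continuous.
- exact: id_lebesgue_borel_measurable.
Qed.

(** Lebesgue measure on Borel sets is the image of the completed measure under
the identity, so this is a change of variables.  It makes the fundamental
theorem of calculus, which is about the Borel version, available. *)
Lemma integral_borel_completed (D : set R) (f : R -> \bar R) :
  measurable D -> measurable_fun (D : set (measurableTypeR R)) f ->
  (forall y, D y -> 0 <= f y)%E ->
  (\int[mu]_(x in D) f x = \int[lebesgue_measure]_(x in D) f x)%E.
Proof.
move=> mD mf f0.
have <- := ge0_integral_pushforward (@id_lebesgue_borel_measurable setT) mu
  mD mf.
  apply: (eq_measure_integral lebesgue_measure) => //.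
  exact: id_lebesgue_borel_measurable.
by move=> y /set_mem; exact: f0.
Qed.

Lemma Rintegral_expRB (t : R) : 0 <= t ->
  Rintegral mu `[0, t]%classic (fun z => expR (z - t)) = 1 - expR (- t).
Proof.
move=> t0; rewrite /Rintegral integral_borel_completed; last first.
- by move=> y _; rewrite lee_fin expR_ge0.
- apply/measurable_EFinP; apply: measurable_funTS.
  by apply: continuous_measurable_fun; exact: expRB_continuous.
- exact: measurable_itv.
move: t0; rewrite le_eqVlt => /predU1P[<-|t0].
  by rewrite set_itv1 integral_set1 oppr0 expR0 subrr.
have dE (z : R) : is_derive z 1 (fun z => expR (z - t)) (expR (z - t)).
  by apply: is_derive_eq; rewrite subr0 /GRing.scale/= mulr1.
rewrite (@continuous_FTC2 _ _ (fun z => expR (z - t))) //.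
- by rewrite /= subrr expR0 sub0r.
- by apply: continuous_subspaceT; exact: expRB_continuous.
- split=> [z _||].
  + exact: ex_derive.
  + by apply: cvg_at_right_filter; exact: expRB_continuous.
  + by apply: cvg_at_left_filter; exact: expRB_continuous.
- by move=> z _; rewrite derive1E derive_val.
Qed.

Lemma bounded_integrable_itv (t M : R) (h : R -> R) :
  measurable_fun (`[0, t]%classic : set (lebesgueR R)) h ->
  (forall z, 0 <= z <= t -> `|h z| <= M) ->
  mu.-integrable `[0, t]%classic (EFin \o h).
Proof.
move=> mh hM; apply: measurable_bounded_integrable => //.
- exact: itv_lebesgue_measurable.
(* On intervals the two measures agree by definition. *)
- have : (lebesgue_measure (`[0%R, t] : set R) < +oo)%E.
    by rewrite lebesgue_measure_itv; case: ifP => _; rewrite ?ltry// -EFinB ltry.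
  exact.
- exists M; split; first exact: num_real.
  move=> N MN z /=; rewrite in_itv/= => /hM hz; exact: le_trans hz (ltW MN).
Qed.

End LebesgueTime.

(** * The contraction property of the integral operator *)

Section Comparison.
Set Implicit Arguments.
Unset Strict Implicit.
Local Open Scope classical_set_scope.
Context {R : realType} {m : nat} (F : 'rV[R]_m -> R).
Hypothesis hF : averaging_operator F.

Lemma Linfty_loc_bounded (u : tree m -> R -> R) (T : R) :
  Linfty_loc u -> 0 < T ->
  exists M, forall x z, 0 <= z <= T -> `|u x z| <= M.
Proof.
move=> [_ /(_ T)] hu /hu[M [_ hM]]; exists (M + 1) => x z zT.
by apply: (hM (M + 1) _ (x, z)) => //; rewrite ltrDl.
Qed.

Lemma K_integrand_integrable (u : tree m -> R -> R) (x : tree m) (t : R) :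
  Linfty_loc u ->
  (@completed_lebesgue_measure R).-integrable `[0, t]%classic
    (EFin \o (fun z => expR (z - t) * F (\row_(i < m) u (succ x i) z))).
Proof.
move=> hu.
(* Local bounds are given for positive horizons, while [t] is arbitrary. *)
have T0 : 0 < `|t| + 1 by rewrite ltr_wpDl.
have [M uM] := Linfty_loc_bounded hu T0.
apply: (@bounded_integrable_itv _ _ M).
- apply: measurable_funM; first exact: expRB_measurable.
  apply: averaging_measurable => // j.
  apply: (measurable_funS _ _ (hu.1 (succ x j))).
  + exact: itv_lebesgue_measurable.
  + by move=> z /=; rewrite !in_itv/= andbT => /andP[].
- move=> z /andP[z0 zt]; rewrite normrM (ger0_norm (expR_ge0 _)).
  have FM : `|F (\row_(i < m) u (succ x i) z)| <= M.
    apply: averaging_bounded => // j; rewrite mxE; apply: uM.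
    by rewrite z0 /= (le_trans zt)// (le_trans (ler_norm t))// lerDl.
  apply: le_trans FM; rewrite ler_piMl// -expR0 ler_expR subr_le0//.
Qed.

(** The terms in [f] and [g] only help.  In the integrals the bound [B] passes
through [F] unchanged, and the kernel [e^(z - t)] has mass [1 - e^(- t)] on
[0, t]: that this is less than [1] is what makes the iteration converge. *)
Lemma K_contraction (f g : tree m -> R) (u v : tree m -> R -> R) (B t : R) :
  (forall x, f x <= g x) -> Linfty_loc u -> Linfty_loc v -> 0 <= t ->
  (forall x z, 0 <= z <= t -> u x z - v x z <= B) ->
  forall x, K F f u x t - K F g v x t <= B * (1 - expR (- t)).
Proof.
move=> fg hu hv t0 uvB x; rewrite /K.
set mu := @completed_lebesgue_measure R; set D := `[0, t]%classic.
have mD : measurable (D : set (lebesgueR R)) by exact: itv_lebesgue_measurable.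
have iE : mu.-integrable D (EFin \o (fun z => expR (z - t))).
  apply: (@bounded_integrable_itv _ _ 1); first exact: expRB_measurable.
  move=> z /andP[_ zt].
  by rewrite ger0_norm ?expR_ge0// -expR0 ler_expR subr_le0.
have iBE : mu.-integrable D (EFin \o (fun z => B * expR (z - t))).
  exact: (integrableZl mD B iE).
have fgE : expR (- t) * f x <= expR (- t) * g x by rewrite ler_pM2l ?expR_gt0.
suff : Rintegral mu D (fun z => expR (z - t) * F (\row_(i < m) u (succ x i) z))
    <= Rintegral mu D (fun z => expR (z - t) * F (\row_(i < m) v (succ x i) z))
       + B * (1 - expR (- t)) by lra.
have iu := K_integrand_integrable x t hu.
have iv := K_integrand_integrable x t hv.
rewrite -Rintegral_expRB// -(RintegralZl B mD iE) -(RintegralD mD iv iBE).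
apply: (le_Rintegral mD iu); first exact: (integrableD mD iv iBE).
move=> z; rewrite /D/= in_itv/= => zt.
rewrite [B * _]mulrC -mulrDr ler_pM2l ?expR_gt0//.
apply: averaging_le_shift => // j; rewrite !mxE -lerBlDl.
exact: uvB.
Qed.

End Comparison.

Theorem theorem1p2 (R : realType) (m : nat) (hm : (2 < m)%N)
    (F : 'rV[R]_m -> R) (hF : averaging_operator F)
    (f g : tree m -> R) (hf : Linfty f) (hg : Linfty g)
    (hfg : forall x : tree m, f x <= g x)
    (u v : tree m -> R -> R) (hu : Linfty_loc u) (hv : Linfty_loc v)
    (huK : forall (x : tree m) (t : R), 0 <= t -> u x t <= K F f u x t)
    (hvK : forall (x : tree m) (t : R), 0 <= t -> K F g v x t <= v x t) :
  forall (x : tree m) (t : R), 0 <= t -> u x t <= v x t.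
Proof.
move=> x T T0.
(* The horizon [T + 1] covers the case [T = 0]. *)
have T1 : 0 < T + 1 by rewrite ltr_wpDl.
have [Mu uM] := Linfty_loc_bounded hu T1.
have [Mv vM] := Linfty_loc_bounded hv T1.
have M0 : 0 <= Mu + Mv.
  have xT : 0 <= T <= T + 1 by rewrite T0 /= lerDl.
  exact: addr_ge0 (le_trans (normr_ge0 _) (uM x T xT))
    (le_trans (normr_ge0 _) (vM x T xT)).
pose q := 1 - expR (- T).
have q0 : 0 <= q by rewrite subr_ge0 -expR0 ler_expR oppr_le0.
have q1 : q < 1 by rewrite ltrBlDr ltrDl expR_gt0.
have iter n : forall y t, 0 <= t <= T -> u y t - v y t <= (Mu + Mv) * q ^+ n.
  elim: n => [|n IH] y t /andP[t0 tT].
    have tT1 : 0 <= t <= T + 1 by rewrite t0 /= (le_trans tT)// lerDl.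
    rewrite expr0 mulr1 (le_trans (ler_norm _))// (le_trans (ler_normB _ _))//.
    by rewrite lerD ?uM ?vM.
  have Bn : 0 <= (Mu + Mv) * q ^+ n by rewrite mulr_ge0// exprn_ge0.
  apply: (@le_trans _ _ (K F f u y t - K F g v y t)).
    by rewrite lerB ?huK ?hvK.
  apply: (@le_trans _ _ ((Mu + Mv) * q ^+ n * (1 - expR (- t)))).
    apply: K_contraction => // z s /andP[s0 st].
    by apply: IH; rewrite s0 (le_trans st).
  rewrite exprSr mulrA ler_wpM2l// lerB// ler_expR lerN2//.
rewrite -subr_le0.
have lim0 : ((Mu + Mv) * q ^+ n @[n --> \oo] --> (0 : R))%classic.
  by apply: cvg_geometric; rewrite ger0_norm.
(* The constant [u x T - v x T] lies below a sequence tending to [0]. *)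
rewrite -(cvg_lim (@Rhausdorff R) lim0).
apply: limr_ge; first exact: cvgP lim0.
by apply: nearW => n; apply: iter; rewrite T0 lexx.
Qed.
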